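(* Let $n$ and $k$ be positive integers and let $x$ be a soldier in the Texas Chainsaw Josephus Game with $n$ soldiers and parameter $k$, so $0\le x\le n-1$. (1) If $x=(k+1)m+s$ with $m\ge 0$ an integer and $1\le s\le k$, then soldier $x$ is eliminated after $x-m$ seconds. (2) If $x=(k+1)m$ with $m\ge 0$ an integer, then there exist unique nonnegative integers $a$ and $b$ such that $n-km=a(k+1)^b$ and $a\not\equiv 0 \pmod{k+1}$. Dividing $a$ by $k+1$, write $a=(k+1)q+r$ with $q, r$ integers and $0<r<k+1$. Then soldier $x$ is eliminated after $n-q$ seconds.
   Context: Texas Chainsaw Josephus Game with $n$ soldiers and parameter $k\ge 1$: soldiers labeled $0,1,\dots,n-1$ stand in a circle in this cyclic order. Starting with soldier $0$, the soldiers still in the circle are visited one at a time in cyclic order of increasing label (after the largest remaining label comes the smallest remaining label). Number the visits $0,1,2,\dots$. At visit $j$, the visited soldier is skipped (stays in the circle) if $j\equiv 0 \pmod{k+1}$, and is eliminated (removed from the circle) otherwise. In other words, one soldier is skipped, then $k$ consecutive soldiers are eliminated, and this repeats. The game continues until one soldier remains. Time convention: ''eliminated after $t$ seconds'' means that the soldier is the $t$-th one in the elimination order, i.e. each elimination takes one second and skips take no time. The last remaining soldier (the survivor) is regarded as being eliminated last, i.e. after $n$ seconds. For example, for $n=10$, $k=2$ the elimination order is $1,2,4,5,7,8,0,3,9,6$, where $6$ is the survivor. *)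

(* Defs.v *)
From mathcomp Require Import all_boot.

Set Implicit Arguments.
Unset Strict Implicit.
Unset Printing Implicit Defensive.

(* The circle is a queue whose head is the soldier to be visited next; a skipped
   soldier goes to the back, which preserves the cyclic order.  The second
   component lists the eliminated soldiers, the earliest first. *)
Definition state : Type := (seq nat * seq nat)%type.

(* The visit number j; nothing happens once a single soldier is left. *)
Definition visit (k j : nat) (st : state) : state :=
  match st with
  | (x :: ((_ :: _) as c), e) =>
      if j == 0 %[mod k.+1] then (rcons c x, e) else (c, rcons e x)
  | _ => st
  end.

(* The state after the visits 0, ..., v - 1. *)
Fixpoint game (n k v : nat) : state :=
  if v is j.+1 then visit k j (game n k j) else (iota 0 n, [::]).

(* The survivor y counts as eliminated last. *)
Definition elimination_order (n k : nat) (o : seq nat) : Prop :=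
  exists v e y, game n k v = ([:: y], e) /\ o = rcons e y.

(* Positions in the elimination order are counted from 1. *)
Definition eliminated_after (n k x t : nat) : Prop :=
  exists o, [/\ elimination_order n k o, 0 < t & onth o t.-1 = Some x].

Example elimination_order_10_2 :
  elimination_order 10 2 [:: 1; 2; 4; 5; 7; 8; 0; 3; 9; 6].
Proof. by exists 20, [:: 1; 2; 4; 5; 7; 8; 0; 3; 9], 6. Qed.

(* Main.v *)
(* Let visit [j] be made to soldier [occupant j].  A soldier skipped at visit
   [(k+1) m] is next seen at visit [n + m], and the [t+1]-st elimination occurs
   at visit [t + t %/ k + 1].  If [x] is visited at [(k+1) m], then
   [d = n - k m] is the delay until its next visit.  When [k+1] divides [d],
   that visit is again a skip and the new delay is [d / (k+1)]; otherwise [x]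
   is eliminated there. *)
Require Import Defs.
From mathcomp Require Import all_boot zify.

Set Implicit Arguments.
Unset Strict Implicit.
Unset Printing Implicit Defensive.

(** Inverts the move from skip [k.+1 * m] to visit [n + m]; first visits are fixed points, so
    iteration stops at the soldier's label. *)
Definition previous_visit (n k j : nat) : nat :=
  if j < n then j else k.+1 * (j - n).

(* Meaningful only while [k * j < k.+1 * n]: beyond that bound
   [previous_visit] no longer decreases. *)
Definition occupant (n k j : nat) : nat := iter j (previous_visit n k) j.

Definition elimination_visit (k t : nat) : nat := (t + t %/ k).+1.

(** The [.-1] discounts the skip that opens the current round, and truncates to 0 when [v] itself
    opens a round. *)
Definition eliminated_before (k v : nat) : nat :=
  k * (v %/ k.+1) + (v %% k.+1).-1.

(** The bound on [j] gives [k.+1 * (j - n) < j] when [n <= j], so [j] steps are enough fuel to reach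
    a first visit. *)
Lemma iter_previous_visit_lt n k i j :
  j <= i -> k * j < k.+1 * n -> iter i (previous_visit n k) j < n.
Proof.
elim: i j => [|i IHi] j le_ji lt_j; first by rewrite /=; nia.
have [lt_jn | le_nj] := ltnP j n.
  by rewrite iter_fix ?/previous_visit ?lt_jn.
rewrite iterSr {2}/previous_visit (ltnNge j) le_nj; apply: IHi; nia.
Qed.

Lemma iter_previous_visit n k i j :
  j <= i -> k * j < k.+1 * n -> iter i (previous_visit n k) j = occupant n k j.
Proof.
move=> le_ji lt_j; rewrite -(subnK le_ji) iterD; apply: iter_fix.
by rewrite {1}/previous_visit (iter_previous_visit_lt (leqnn j) lt_j).
Qed.

Lemma occupant_small n k j : j < n -> occupant n k j = j.
Proof. by move=> lt_jn; apply: iter_fix; rewrite /previous_visit lt_jn. Qed.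

Lemma occupant_skip n k m :
  k * m < n -> occupant n k (n + m) = occupant n k (k.+1 * m).
Proof.
move=> lt_m; have n_gt0 : 0 < n by lia.
(* One step leads back to [k.+1 * m]; the remaining fuel [n + m - 1] suffices because
   [k * m < n]. *)
rewrite {1}/occupant -(prednK (ltn_addr m n_gt0)) iterSr prednK ?ltn_addr //.
have -> : previous_visit n k (n + m) = k.+1 * m.
  by rewrite /previous_visit ltnNge leq_addr addKn.
apply: iter_previous_visit; nia.
Qed.

Lemma eliminated_beforeE k m s :
  s <= k -> eliminated_before k (k.+1 * m + s) = k * m + s.-1.
Proof.
move=> le_sk; rewrite /eliminated_before [k.+1 * m]mulnC divnMDl // modnMDl.
by rewrite divn_small ?modn_small // addn0.
Qed.

Lemma elimination_visitE k m s :
  0 < s <= k -> elimination_visit k (k * m + s).-1 = k.+1 * m + s.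
Proof.
case: s => // s /andP[_ lt_sk]; have k_gt0 : 0 < k by lia.
rewrite /elimination_visit addnS /= [in X in X %/ k]mulnC divnMDl //.
by rewrite divn_small //; lia.
Qed.

Lemma eliminated_before_visit k t :
  0 < k -> eliminated_before k (elimination_visit k t) = t.
Proof.
move=> k_gt0; have lt_tk := ltn_pmod t k_gt0.
rewrite (_ : elimination_visit k t = k.+1 * (t %/ k) + (t %% k).+1); last first.
  by rewrite /elimination_visit {1}(divn_eq t k); lia.
by rewrite eliminated_beforeE //= mulnC -divn_eq.
Qed.

(** Invariant by induction on visits: the queue is a window of upcoming visits, one per remaining
    soldier. A skip shifts the window, an elimination drops its first entry. *)
Lemma gameE n k v : 0 < k -> eliminated_before k v < n ->
  game n k v =
    ([seq occupant n k j | j <- iota v (n - eliminated_before k v)],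
     mkseq (fun t => occupant n k (elimination_visit k t))
           (eliminated_before k v)).
Proof.
move=> k_gt0; elim: v => [|v IHv].
  rewrite /eliminated_before div0n mod0n muln0 subn0 => _ /=.
  congr pair; rewrite -[LHS]map_id; apply/eq_in_map => j.
  by rewrite mem_iota => /andP[_ lt_jn]; rewrite occupant_small.
have := divn_eq v k.+1; rewrite mulnC.
have : v %% k.+1 <= k by rewrite -ltnS ltn_pmod.
move: (v %/ k.+1) (v %% k.+1) => m [|s] le_sk Ev.
  rewrite addn0 in Ev.
  have Ee : eliminated_before k v = k * m.
    by rewrite Ev -[k.+1 * m]addn0 eliminated_beforeE // addn0.
  have -> : eliminated_before k v.+1 = k * m.
    by rewrite Ev -addn1 eliminated_beforeE //= addn0.
  move=> lt_mn; rewrite /= IHv ?Ee //.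
  have := occupant_skip lt_mn.
  (* The shifted window ends exactly at [n + m], the return of the skipped soldier. *)
  have -> : n + m = v.+1 + (n - k * m).-1 by lia.
  rewrite -Ev.
  have Dl : n - k * m = (n - k * m).-1.+1 by rewrite prednK // subn_gt0.
  rewrite {}Dl; move: (n - k * m).-1 => [|l] Eocc.
    (* With one soldier left the state is frozen, and [v.+1] is [n + m]. *)
    by rewrite /= -Eocc addn0.
  have -> : iota v.+1 l.+2 = rcons (iota v.+1 l.+1) (v.+1 + l.+1).
    by rewrite -cats1 -(iotaD v.+1 l.+1 1) addn1.
  by rewrite map_rcons Eocc /= {1}Ev modnMr mod0n.
have Ee : eliminated_before k v = k * m + s.
  by rewrite Ev eliminated_beforeE.
have -> : eliminated_before k v.+1 = (k * m + s).+1.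
  case: (ltnP s.+1 k) => [lt_sk | ge_sk].
    by rewrite Ev -addnS eliminated_beforeE //= addnS.
  have -> : v.+1 = k.+1 * m.+1 + 0 by lia.
  by rewrite eliminated_beforeE //=; lia.
move=> lt_n; rewrite /= IHv ?Ee; last by lia.
(* At least two soldiers are present, so the visit does eliminate. *)
have -> : n - (k * m + s) = (n - (k * m + s).+1).-1.+2 by lia.
have -> : n - (k * m + s).+1 = (n - (k * m + s).+1).-1.+1 by lia.
rewrite /= {1}Ev mulnC modnMDl mod0n modn_small //=; congr pair.
rewrite mkseqS; congr rcons.
by rewrite Ev -(@elimination_visitE k m s.+1) // addnS.
Qed.

Lemma eliminated_after_occupant n k t : 0 < k -> 0 < t <= n ->
  eliminated_after n k (occupant n k (elimination_visit k t.-1)) t.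
Proof.
move=> k_gt0 /andP[t_gt0 le_tn]; have n_gt0 := leq_trans t_gt0 le_tn.
pose F i := occupant n k (elimination_visit k i).
exists (mkseq F n); split=> //.
  (* Stop just before the visit that would eliminate the survivor: it is then alone in the queue, so
     [F] covers it too. *)
  exists (elimination_visit k n.-1), (mkseq F n.-1), (F n.-1); split.
    rewrite gameE ?eliminated_before_visit ?prednK //.
    by have -> : n - n.-1 = 1 by lia.
  by rewrite -mkseqS prednK.
by rewrite onthE -map_comp nth_mkseq ?prednK.
Qed.

Lemma eliminated_after_visit n k m s : 0 < s <= k -> k * m + s <= n ->
  eliminated_after n k (occupant n k (k.+1 * m + s)) (k * m + s).
Proof.
move=> s_bounds le_n; rewrite -elimination_visitE //.
by apply: eliminated_after_occupant; lia.
Qed.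

Lemma eliminated_after_skip n k m a b : 0 < k ->
  n - k * m = a * k.+1 ^ b -> 0 < a %% k.+1 ->
  eliminated_after n k (occupant n k (k.+1 * m)) (n - a %/ k.+1).
Proof.
move=> k_gt0 + r_gt0; elim: b m => [|b IHb] m Ed.
  have := divn_eq a k.+1; have := ltn_pmod a (ltn0Sn k).
  move: r_gt0 Ed; rewrite muln1.
  move: (a %/ k.+1) (a %% k.+1) => q r r_gt0 Ed lt_r Ea.
  have lt_mn : k * m < n by lia.
  (* Here [n = k * m + k.+1 * q + r], so the next visit has residue [r] and is an elimination. *)
  rewrite -occupant_skip //.
  have -> : n + m = k.+1 * (m + q) + r by lia.
  have -> : n - q = k * (m + q) + r by lia.
  by apply: eliminated_after_visit; lia.
set d := a * k.+1 ^ b.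
have {}Ed : n - k * m = k.+1 * d by rewrite Ed expnS mulnCA.
have d_gt0 : 0 < d.
  by rewrite muln_gt0 expn_gt0 andbT; case: (a) r_gt0; rewrite ?mod0n.
have lt_mn : k * m < n by lia.
rewrite -occupant_skip // (_ : n + m = k.+1 * (m + d)); last by lia.
by apply: IHb; rewrite -/d; lia.
Qed.

Lemma power_part_exists K d : 1 < K -> 0 < d ->
  exists a b, d = a * K ^ b /\ ~~ (K %| a).
Proof.
move=> K_gt1; elim/ltn_ind: d => d IHd d_gt0.
case: (boolP (K %| d)) => [/dvdnP[c Ed] | ndvd]; last first.
  by exists d, 0; rewrite muln1.
have [a [b [Ec ndvd]]] : exists a b, c = a * K ^ b /\ ~~ (K %| a).
  by apply: IHd; nia.
by exists a, b.+1; rewrite Ed Ec expnSr mulnA.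
Qed.

Lemma power_part_unique K a b a' b' : 0 < K -> ~~ (K %| a) -> ~~ (K %| a') ->
  a * K ^ b = a' * K ^ b' -> (a, b) = (a', b').
Proof.
move=> K_gt0 ndvd ndvd'; elim: b b' => [|b IHb] [|b'].
- by rewrite !muln1 => ->.
- by move=> E; case/negP: ndvd; rewrite -[a]muln1 E expnSr mulnA dvdn_mull.
- by move=> E; case/negP: ndvd'; rewrite -[a']muln1 -E expnSr mulnA dvdn_mull.
rewrite !expnSr !mulnA => /eqP; rewrite eqn_pmul2r // => /eqP/IHb.
by case=> -> ->.
Qed.

Theorem theorem3 (n k x : nat) (hn : 0 < n) (hk : 0 < k) (hx : x < n) :
  (forall m s : nat, x = k.+1 * m + s -> 1 <= s <= k ->
     eliminated_after n k x (x - m)) /\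
  (forall m : nat, x = k.+1 * m ->
     (exists! ab : nat * nat,
        n - k * m = ab.1 * k.+1 ^ ab.2 /\ ab.1 != 0 %[mod k.+1]) /\
     (forall a b : nat, n - k * m = a * k.+1 ^ b -> a != 0 %[mod k.+1] ->
        exists q r : nat,
          [/\ a = k.+1 * q + r, 0 < r < k.+1 & eliminated_after n k x (n - q)])).
Proof.
split=> [m s Ex s_bounds | m Ex].
  (* As [x < n], soldier [x] is first met at visit [x]. *)
  rewrite -{1}(@occupant_small n k x hx) {1}Ex.
  have -> : x - m = k * m + s by lia.
  by apply: eliminated_after_visit => //; lia.
split=> [|a b Ed].
  have d_gt0 : 0 < n - k * m by lia.
  have [a [b [Ed ndvd]]] := power_part_exists (hk : 1 < k.+1) d_gt0.
  exists (a, b); split; first by rewrite mod0n.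
  move=> [a' b'] /= [Ed' ]; rewrite mod0n => ndvd'.
  by apply: (@power_part_unique k.+1) => //; rewrite -Ed.
rewrite mod0n -lt0n => r_gt0; exists (a %/ k.+1), (a %% k.+1).
rewrite [k.+1 * _]mulnC -divn_eq r_gt0 ltn_pmod //; split=> //.
rewrite -{1}(@occupant_small n k x hx) Ex.
exact: eliminated_after_skip Ed r_gt0.
Qed.
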